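(* Let $g_1,g_2:[0,1]\to[0,1]$ be unimodal maps and suppose that $g_1^{-\infty}(0)$ is dense in $[0,1]$. Then $g_1$ and $g_2$ are topologically conjugate if and only if $g_2^{-\infty}(0)$ is dense in $[0,1]$. Moreover, in this case the conjugacy is unique.
   Context: A unimodal map is a continuous map $g:[0,1]\to[0,1]$ for which there is $v\in(0,1)$ such that $g$ is strictly increasing on $[0,v]$, strictly decreasing on $[v,1]$, and $g(0)=g(1)=0$, $g(v)=1$. The complete pre-image of $0$ is $g^{-\infty}(0)=\bigcup_{n\ge1}\{x\in[0,1]:g^n(x)=0\}$, where $g^n$ is the $n$-th iterate. A conjugacy of $g_1$ and $g_2$ is a homeomorphism $h:[0,1]\to[0,1]$ with $h\circ g_1=g_2\circ h$; the maps are topologically conjugate if such an $h$ exists. *)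

(* Defs.v *)
From HB Require Import structures.
From mathcomp Require Import all_boot all_order all_algebra.
From mathcomp Require Import all_classical all_reals all_analysis.

Set Implicit Arguments.
Unset Strict Implicit.
Unset Printing Implicit Defensive.

Import Order.TTheory GRing.Theory Num.Theory.
Import numFieldNormedType.Exports.

Local Open Scope classical_set_scope.
Local Open Scope ring_scope.

(* Self-maps of [0, 1] are represented by functions R -> R; every condition
   below only concerns their values on [0, 1]. *)

Definition I01 (R : realType) : set R := `[0, 1].
Arguments I01 R : clear implicits.

Definition unimodal (R : realType) (g : R -> R) : Prop :=
  [/\ set_fun (I01 R) (I01 R) g,
      {within I01 R, continuous g} &
      exists2 v : R, 0 < v < 1 &
        [/\ {in `[0, v]%R &, {homo g : x y / x < y}},
            {in `[v, 1]%R &, {homo g : x y / x < y >-> y < x}},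
            g 0 = 0, g 1 = 0 & g v = 1]].

Definition preimage_of_zero (R : realType) (g : R -> R) : set R :=
  \bigcup_(n in [set n | (1 <= n)%N]) [set x | I01 R x /\ iter n g x = 0].

(* Density relative to the subset A.  The library's [dense] is relative to a
   whole topological type, and on [subspace A] the points outside A are
   isolated, so it cannot be used there. *)
Definition dense_in (T : topologicalType) (A S : set T) : Prop :=
  S `<=` A /\ A `<=` closure S.

Definition homeomorphism_on (T U : topologicalType) (A : set T) (B : set U)
    (h : T -> U) : Prop :=
  exists k : U -> T,
    [/\ set_fun A B h /\ set_fun B A k,
        {in A, cancel h k}, {in B, cancel k h},
        {within A, continuous h} & {within B, continuous k}].

Definition conjugacy (R : realType) (g1 g2 h : R -> R) : Prop :=
  homeomorphism_on (I01 R) (I01 R) h /\ {in I01 R, h \o g1 =1 g2 \o h}.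

Definition topologically_conjugate (R : realType) (g1 g2 : R -> R) : Prop :=
  exists h : R -> R, conjugacy g1 g2 h.

(* Main.v *)
Require Import Defs.
From mathcomp Require Import all_boot all_order all_algebra.
From mathcomp Require Import all_classical all_reals all_analysis.
From mathcomp Require Import lra.
Import numFieldNormedType.Exports.
Import Order.TTheory GRing.Theory Num.Theory.

Local Open Scope classical_set_scope.
Local Open Scope ring_scope.

(** Both directions and the uniqueness rest on comparing itineraries.  Let
    [v1], [v2] be the turning points of [g1], [g2].  A point [y] follows a
    point [x] when, at every time [n], [g2^n y] lies on the same closed side of
    [v2] as [g1^n x] does of [v1]; in particular [g2^n y = v2] whenever
    [g1^n x = v1].

    If [g^{-oo}(0)] is dense, an itinerary determines its point
    ([cosided_eq]): were [x < x'] always on a common side, every iterate would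
    be strictly monotone on [[x, x']], but some [p] strictly between them is
    sent to [0] by an iterate, and [0] is not strictly between two points of
    [[0, 1]].  Conversely, every [x] is followed by some [y]
    ([exists_follower]): finitely many steps of its itinerary are realised
    by pulling back along the branches of [g2], and compactness of [[0, 1]]
    takes care of all steps at once.

    So, when both preimages of zero are dense, sending [x] to the point that
    follows it is a well-defined map [h].  Following is transitive and
    reflexive, hence the map built the other way round is the inverse of [h];
    following is compatible with the dynamics, hence [h] intertwines [g1] and
    [g2]; and [h] is monotone ([follows_le]), because a pair of points and the
    pair following it are carried, as long as both pairs stay on common sides,
    through branches of the same orientation.  A monotone bijection of a
    segment is a homeomorphism.

    In the other direction, a conjugacy is increasing, as a decreasing one
    would send the fixed point [0] to [1].  It thus sends [v1] to [v2], and
    [h x] follows [x] for every [x].  An increasing bijection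
    carries the density of the preimage of zero over to [g2], and then
    [h x], as the only point that follows [x], is determined. *)

(** * Unimodal maps with a marked turning point *)

Definition unimodal_at {R : realType} (g : R -> R) (v : R) : Prop :=
  [/\ set_fun (I01 R) (I01 R) g, {within I01 R, continuous g}, 0 < v < 1 &
      [/\ {in `[0, v]%R &, {homo g : x y / x < y}},
          {in `[v, 1]%R &, {homo g : x y / x < y >-> y < x}},
          g 0 = 0, g 1 = 0 & g v = 1]].

Section UnimodalAt.
Context {R : realType} {g : R -> R} {v : R}.
Hypothesis ug : unimodal_at g v.

Lemma I01E (x : R) : I01 R x <-> 0 <= x <= 1.
Proof. by rewrite /I01 /= in_itv. Qed.

Lemma unimodal_at_I01 (x : R) : I01 R x -> I01 R (g x).
Proof. by case: ug => + _ _ _; apply. Qed.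

Lemma iter_I01 (n : nat) (x : R) : I01 R x -> I01 R (iter n g x).
Proof. by move=> Ix; elim: n => //= n; exact: unimodal_at_I01. Qed.

Lemma turning_point_I01 : I01 R v.
Proof. by case: ug => _ _ /andP[v0 v1] _; rewrite I01E !ltW. Qed.

Lemma increasing_left (x y : R) : 0 <= x -> x < y -> y <= v -> g x < g y.
Proof.
case: ug => _ _ _ [inc _ _ _ _] x0 xy yv.
by apply: inc; rewrite ?in_itv //=; lra.
Qed.

Lemma decreasing_right (x y : R) : v <= x -> x < y -> y <= 1 -> g y < g x.
Proof.
case: ug => _ _ _ [_ dec _ _ _] vx xy y1.
by apply: dec; rewrite ?in_itv //=; lra.
Qed.

Lemma unimodal_at_max (x : R) : I01 R x -> g x = 1 -> x = v.
Proof.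
case: (ug) => _ _ _ [_ _ _ _ gv] /I01E/andP[x0 x1] gx.
case: (ltgtP x v) => // [xv|vx].
- by have := increasing_left _ _ x0 xv (lexx _); rewrite gv gx ltxx.
- by have := decreasing_right _ _ (lexx _) vx x1; rewrite gv gx ltxx.
Qed.

Lemma left_branch_surj (y : R) : I01 R y ->
  exists2 x, I01 R x & x <= v /\ g x = y.
Proof.
move=> /I01E; case: (ug) => _ cg /andP[v0 v1] [_ _ g0 _ gv] y01.
have sub : `[0, v] `<=` I01 R.
  move=> z; rewrite I01E /= in_itv /= => /andP[-> zv].
  by rewrite ltW// (le_lt_trans zv).
have [||c] := @IVT _ g 0 v y (ltW v0); first exact: continuous_subspaceW cg.
  by rewrite g0 gv min_l ?max_r.
by move=> cv; exists c; [exact: sub|move: cv; rewrite in_itv /= => /andP[]].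
Qed.

Lemma right_branch_surj (y : R) : I01 R y ->
  exists2 x, I01 R x & v <= x /\ g x = y.
Proof.
move=> /I01E; case: (ug) => _ cg /andP[v0 v1] [_ _ _ g1 gv] y01.
have sub : `[v, 1] `<=` I01 R.
  move=> z; rewrite I01E /= in_itv /= => /andP[vz ->].
  by rewrite andbT (le_trans _ vz)// ltW.
have [||c] := @IVT _ g v 1 y (ltW v1); first exact: continuous_subspaceW cg.
  by rewrite g1 gv min_r ?max_l.
by move=> cv; exists c; [exact: sub|move: cv; rewrite in_itv /= => /andP[]].
Qed.

Lemma closed_iter_preimage (n : nat) (C : set R) :
  closed C -> closed (I01 R `&` iter n g @^-1` C).
Proof.
have cI : closed (I01 R) by exact: interval_closed.
move=> cC; elim: n => [|n IH]; first exact: closedI.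
case: (ug) => _ /continuous_closedP cg _ _.
(* As [g] maps the segment to itself, the preimage under one more iterate is
   the preimage under [g] of the set already known to be closed. *)
have -> : I01 R `&` iter n.+1 g @^-1` C =
          I01 R `&` g @^-1` (I01 R `&` iter n g @^-1` C).
  apply/seteqP; split => x [Ix] /=; rewrite -iterS iterSr.
    by move=> Cx; split => //; split => //; exact: unimodal_at_I01.
  by case=> _ Cx; split.
by have := cg _ IH; rewrite -(closed_setSI _ cI).
Qed.

(** * Density and itineraries *)

(** Strict inequalities confine the density hypothesis to the interior, where
    neighbourhoods in the segment and in the line agree. *)
Lemma dense_inP (S : set R) : S `<=` I01 R ->
  dense_in (I01 R) S <->
  forall a b, I01 R a -> I01 R b -> a < b -> exists2 p, S p & a < p < b.
Proof.
move=> SI; split=> [[_ dS] a b /I01E/andP[a0 a1] /I01E/andP[b0 b1] ab|dS].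
  have Iab : I01 R ((a + b) / 2) by apply/I01E; lra.
  have [|p [Sp]] := dS _ Iab [set` `]a, b[].
    by apply: near_in_itvoo; rewrite in_itv /=; lra.
  by rewrite /= in_itv /= => abp; exists p.
split=> // x /I01E/andP[x0 x1] U /nbhs_ballP[e /= e0 eU].
pose a := Num.max 0 (x - e); pose b := Num.min 1 (x + e).
have ax : 0 <= a /\ x - e <= a by rewrite !le_max !lexx orbT.
have bx : b <= 1 /\ b <= x + e by rewrite !ge_min !lexx orbT.
have ab : a < b by rewrite gt_max !lt_min; lra.
have [||//|p Sp pab] := dS a b; try by apply/I01E; lra.
by exists p; split => //; apply: eU; rewrite /ball /= ltr_distlC; lra.
Qed.

Definition cosided (x x' : R) : Prop :=
  forall n, (iter n g x <= v /\ iter n g x' <= v) \/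
            (v <= iter n g x /\ v <= iter n g x').

Lemma cosided_sym (x x' : R) : cosided x x' -> cosided x' x.
Proof. by move=> c n; case: (c n) => [[]|[]]; [left|right]. Qed.

(** A point between two cosided points stays between their images, since
    both images are taken along one branch at each step. *)
Lemma cosided_between (x p x' : R) : I01 R x -> I01 R p -> I01 R x' ->
  cosided x x' -> x < p < x' ->
  forall n, iter n g x < iter n g p < iter n g x' \/
            iter n g x' < iter n g p < iter n g x.
Proof.
move=> Ix Ip Ix' c xpx'; elim=> [|n]; first by left.
have /I01E := iter_I01 n _ Ix; have /I01E := iter_I01 n _ Ip.
have /I01E := iter_I01 n _ Ix'; move: (c n) => /=.
set a := iter n g x; set b := iter n g p; set d := iter n g x'.
move=> side /andP[d0 d1] /andP[b0 b1] /andP[a0 a1] [] /andP[lt1 lt2];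
  case: side => -[? ?].
- by left; rewrite !increasing_left //; lra.
- by right; rewrite !decreasing_right //; lra.
- by right; rewrite !increasing_left //; lra.
- by left; rewrite !decreasing_right //; lra.
Qed.

Hypothesis dg : dense_in (I01 R) (preimage_of_zero g).

Lemma preimage_of_zero_sub : preimage_of_zero g `<=` I01 R.
Proof. by move=> x [n _ []]. Qed.

Lemma cosided_not_lt (x x' : R) :
  I01 R x -> I01 R x' -> cosided x x' -> ~ x < x'.
Proof.
move=> Ix Ix' c xx'.
have [p [n _ [Ip gp]] xpx'] :=
  (dense_inP _ preimage_of_zero_sub).1 dg _ _ Ix Ix' xx'.
have /I01E/andP[gx0 _] := iter_I01 n _ Ix.
have /I01E/andP[gx0' _] := iter_I01 n _ Ix'.
by case: (cosided_between _ _ _ Ix Ip Ix' c xpx' n); rewrite gp; lra.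
Qed.

Lemma cosided_eq (x x' : R) : I01 R x -> I01 R x' -> cosided x x' -> x = x'.
Proof.
move=> Ix Ix' c; case: (ltgtP x x') => // xx'.
- by case: (cosided_not_lt _ _ Ix Ix' c).
- by case: (cosided_not_lt _ _ Ix' Ix (cosided_sym _ _ c)).
Qed.

End UnimodalAt.

(** * Points with prescribed itinerary *)

(** The condition is on closed sides, so that it is closed in [b], but it is
    not symmetric: it forces [b = w] when [a = v], and not the other way
    round. *)
Definition same_side {R : realType} (v w a b : R) : Prop :=
  (a <= v -> b <= w) /\ (v <= a -> w <= b).

Definition follows {R : realType} (g1 g2 : R -> R) (v1 v2 x y : R) : Prop :=
  forall n, same_side v1 v2 (iter n g1 x) (iter n g2 y).

Lemma closed_same_side (R : realType) (v w a : R) :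
  closed [set b | same_side v w a b].
Proof.
have -> : [set b | same_side v w a b] =
    (if a <= v then [set b | b <= w] else setT) `&`
    (if v <= a then [set b | w <= b] else setT).
  apply/seteqP; split => b /=; rewrite /same_side.
    by case: (a <= v); case: (v <= a) => -[h1 h2]; split => //=; auto.
  by case: (a <= v); case: (v <= a) => -[h1 h2]; split => //=.
by apply: closedI; case: ifP => _;
  [exact: closed_le|exact: closedT|exact: closed_ge|exact: closedT].
Qed.

Lemma nested_closed_nonempty (R : realType) (S : nat -> set R) :
  (forall n, closed (S n)) -> (forall n m, (n <= m)%N -> S m `<=` S n) ->
  (forall n, S n `<=` I01 R) -> (forall n, S n !=set0) ->
  exists y, forall n, S n y.
Proof.
move=> cS dS SI /choice[u Su].
have [|y [_ cy]] := @segment_compact R 0 1 (u @ \oo) _.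
  by exists 0 => // n _; apply: SI; exact: Su.
exists y => n; apply: cS => U yU; apply: cy => //.
by exists n => // m /= nm; apply: (dS _ _ nm); exact: Su.
Qed.

Section Following.
Context {R : realType} {g1 g2 : R -> R} {v1 v2 : R}.
Hypotheses (ug1 : unimodal_at g1 v1) (ug2 : unimodal_at g2 v2).

Lemma turning_point_follows : follows g1 g2 v1 v2 v1 v2.
Proof.
case: ug1 => _ _ /andP[v10 v11] [_ _ g10 g11 gv1].
case: ug2 => _ _ /andP[v20 v21] [_ _ g20 g21 gv2].
have it0 (g : R -> R) : g 0 = 0 -> forall n, iter n g 0 = 0.
  by move=> g0; elim=> //= n ->.
(* The orbit of a turning point is [v, 1, 0, 0, ...]. *)
case=> [|[|n]]; rewrite /same_side /=; first by rewrite !lexx.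
  by rewrite gv1 gv2; split; lra.
by rewrite -!iterS !iterSr gv1 gv2 g11 g21 !it0 //; split; lra.
Qed.

(** Pulling a follower of [g1 x] back along the branch of [g2] on the side of
    [x] adds one step at the start.  At [x = v1] this would need the follower
    of [g1 x = 1] to be exactly [1], so there [v2], which follows [v1] forever,
    is taken instead. *)
Lemma exists_partial_follower (n : nat) (x : R) : I01 R x ->
  exists2 y, I01 R y &
    forall k, (k < n)%N -> same_side v1 v2 (iter k g1 x) (iter k g2 y).
Proof.
elim: n x => [|n IH] x Ix; first by exists x.
have [z Iz zP] := IH _ (unimodal_at_I01 ug1 _ Ix).
have [xv|vx|->] := ltgtP x v1.
- have [y Iy [yv gy]] := left_branch_surj ug2 _ Iz.
  exists y => // -[_|k kn]; first by rewrite /same_side /=; split; lra.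
  by rewrite !iterSr gy; exact: zP.
- have [y Iy [yv gy]] := right_branch_surj ug2 _ Iz.
  exists y => // -[_|k kn]; first by rewrite /same_side /=; split; lra.
  by rewrite !iterSr gy; exact: zP.
- exists v2; first exact: turning_point_I01 ug2.
  by move=> k _; exact: turning_point_follows.
Qed.

Lemma exists_follower (x : R) : I01 R x ->
  exists2 y, I01 R y & follows g1 g2 v1 v2 x y.
Proof.
move=> Ix.
pose S n := I01 R `&` \bigcap_(k in [set k | (k < n)%N])
  (I01 R `&` iter k g2 @^-1` [set b | same_side v1 v2 (iter k g1 x) b]).
have [|n m nm y [Iy yS]|n y []//|n|y yS] := @nested_closed_nonempty R S.
- move=> n; apply: closedI; first exact: interval_closed.
  apply: closed_bigI => k _; apply: (closed_iter_preimage ug2).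
  exact: closed_same_side.
- by split=> // k kn; apply: yS; exact: leq_trans kn nm.
- have [y Iy yP] := exists_partial_follower n _ Ix.
  by exists y; split => // k kn; split => //; exact: yP.
- exists y; first by case: (yS 0).
  by move=> n; case: (yS n.+1) => _ /(_ n (ltnSn n))[].
Qed.

Lemma exists_following_map : exists h : R -> R, forall x, I01 R x ->
  I01 R (h x) /\ follows g1 g2 v1 v2 x (h x).
Proof.
suff /choice[h hP] : forall x, exists y,
    I01 R x -> I01 R y /\ follows g1 g2 v1 v2 x y by exists h.
move=> x; have [Ix|nIx] := pselect (I01 R x); last by exists 0.
by have [y Iy f] := exists_follower _ Ix; exists y.
Qed.

(** If followers reversed the order of [x < x'], the orders would stay
    opposite forever, as both pairs always move along branches of equal
    orientation; and two points separated by [v1] cannot have followers in the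
    opposite order.  So [x] and [x'] would be cosided. *)
Lemma follows_le (x x' y y' : R) :
  dense_in (I01 R) (preimage_of_zero g1) ->
  I01 R x -> I01 R x' -> I01 R y -> I01 R y' ->
  follows g1 g2 v1 v2 x y -> follows g1 g2 v1 v2 x' y' ->
  x < x' -> y <= y'.
Proof.
move=> dg1 Ix Ix' Iy Iy' f f' xx'; rewrite leNgt; apply/negP => y'y.
pose opposite n :=
  (iter n g1 x < iter n g1 x' /\ iter n g2 y' < iter n g2 y) \/
  (iter n g1 x' < iter n g1 x /\ iter n g2 y < iter n g2 y').
pose sides n := (iter n g1 x <= v1 /\ iter n g1 x' <= v1) \/
                (v1 <= iter n g1 x /\ v1 <= iter n g1 x').
have opp_sides n : opposite n -> sides n.
  rewrite /opposite /sides; have := f n; have := f' n; rewrite /same_side.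
  set a := iter n g1 x; set a' := iter n g1 x'.
  set b := iter n g2 y; set b' := iter n g2 y' => -[p1 p2] [p3 p4] o.
  have [av|va] := leP a v1; have [av'|va'] := leP a' v1;
    [by left|exfalso|exfalso|by right; rewrite !ltW].
  - by have := p3 av; have := p2 (ltW va'); lra.
  - by have := p4 (ltW va); have := p1 av'; lra.
have opp n : opposite n.
  elim: n => [|n IH]; first by left.
  have s := opp_sides n IH; move: IH s; rewrite /opposite /sides /=.
  have := f n; have := f' n; rewrite /same_side.
  have /I01E := iter_I01 ug1 n _ Ix; have /I01E := iter_I01 ug1 n _ Ix'.
  have /I01E := iter_I01 ug2 n _ Iy; have /I01E := iter_I01 ug2 n _ Iy'.
  set a := iter n g1 x; set a' := iter n g1 x'.
  set b := iter n g2 y; set b' := iter n g2 y'.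
  move=> /andP[? ?] /andP[? ?] /andP[? ?] /andP[? ?] [p1 p2] [p3 p4] o.
  case=> -[s s'].
    have {p3 p4} bv := p3 s; have {p1 p2} bv' := p1 s'.
    case: o => -[oa ob]; [left|right].
      by split; apply: (increasing_left ug1) || apply: (increasing_left ug2).
    by split; apply: (increasing_left ug1) || apply: (increasing_left ug2).
  have {p3 p4} bv := p4 s; have {p1 p2} bv' := p2 s'.
  case: o => -[oa ob]; [right|left].
    by split; apply: (decreasing_right ug1) || apply: (decreasing_right ug2).
  by split; apply: (decreasing_right ug1) || apply: (decreasing_right ug2).
by apply: (cosided_not_lt ug1 dg1 _ _ Ix Ix' _ xx') => n; exact: opp_sides.
Qed.

Lemma follows_unique (x y y' : R) :
  dense_in (I01 R) (preimage_of_zero g2) -> I01 R y -> I01 R y' ->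
  follows g1 g2 v1 v2 x y -> follows g1 g2 v1 v2 x y' -> y = y'.
Proof.
move=> dg2 Iy Iy' f f'; apply: (cosided_eq ug2 dg2) => // n.
have [p1 p2] := f n; have [p3 p4] := f' n.
by have /orP[s|s] := le_total (iter n g1 x) v1; [left|right]; auto.
Qed.

Lemma follows_next (x y : R) :
  follows g1 g2 v1 v2 x y -> follows g1 g2 v1 v2 (g1 x) (g2 y).
Proof. by move=> f n; have := f n.+1; rewrite !iterSr. Qed.

End Following.

Lemma follows_trans (R : realType) (g1 g2 g3 : R -> R) (v1 v2 v3 x y z : R) :
  follows g1 g2 v1 v2 x y -> follows g2 g3 v2 v3 y z ->
  follows g1 g3 v1 v3 x z.
Proof.
by move=> f f' n; have [p1 p2] := f n; have [p3 p4] := f' n; split; auto.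
Qed.

Lemma follows_refl (R : realType) (g : R -> R) (v x : R) :
  follows g g v v x x.
Proof. by []. Qed.

(** * From density to a conjugacy *)

Lemma monotone_bijection_continuous (R : realType) (h k : R -> R) :
  set_fun (I01 R) (I01 R) h -> set_fun (I01 R) (I01 R) k ->
  {in I01 R, cancel h k} -> {in I01 R, cancel k h} ->
  (forall x y, I01 R x -> I01 R y -> x < y -> h x <= h y) ->
  {within I01 R, continuous h}.
Proof.
move=> hI kI hK kK hle.
have hlt x y : I01 R x -> I01 R y -> x < y -> h x < h y.
  move=> Ix Iy xy; rewrite lt_neqAle (hle _ _ Ix Iy xy) andbT.
  apply/eqP => /(congr1 k); rewrite !hK ?inE // => exy.
  by move: xy; rewrite exy ltxx.
apply: segment_inc_surj_continuous.
  move=> x y Ix Iy; apply/idP/idP => [hxy|].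
    by rewrite leNgt; apply/negP => /(hlt _ _ Iy Ix); rewrite ltNge hxy.
  by rewrite le_eqVlt => /predU1P[->//|/(hle _ _ Ix Iy)].
have [I0 I1] : I01 R 0 /\ I01 R 1 by rewrite !I01E; lra.
move=> y /=; rewrite in_itv /= => /andP[hy yh].
have /I01E/andP[h00 _] := hI _ I0; have /I01E/andP[_ h11] := hI _ I1.
have Iy : I01 R y by apply/I01E; lra.
by exists (k y); [exact: kI|rewrite kK ?inE].
Qed.

Lemma dense_conjugate (R : realType) (g1 g2 : R -> R) (v1 v2 : R) :
  unimodal_at g1 v1 -> unimodal_at g2 v2 ->
  dense_in (I01 R) (preimage_of_zero g1) ->
  dense_in (I01 R) (preimage_of_zero g2) -> topologically_conjugate g1 g2.
Proof.
move=> ug1 ug2 dg1 dg2.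
have [h hP] := exists_following_map ug1 ug2.
have [k kP] := exists_following_map ug2 ug1.
have hI : set_fun (I01 R) (I01 R) h by move=> x /hP[].
have kI : set_fun (I01 R) (I01 R) k by move=> x /kP[].
have hK : {in I01 R, cancel h k}.
  move=> x; rewrite inE => Ix.
  have [Ihx fx] := hP _ Ix; have [Ikx fhx] := kP _ Ihx.
  apply: (follows_unique ug1 (g1 := g1) (v1 := v1)) => //.
  - exact: follows_trans fx fhx.
  - exact: follows_refl.
have kK : {in I01 R, cancel k h}.
  move=> x; rewrite inE => Ix.
  have [Ikx fx] := kP _ Ix; have [Ihx fkx] := hP _ Ikx.
  apply: (follows_unique ug2 (g1 := g2) (v1 := v2)) => //.
  - exact: follows_trans fx fkx.
  - exact: follows_refl.
exists h; split; last first.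
  move=> x; rewrite inE => Ix /=; have [Ihx fx] := hP _ Ix.
  have [Ihgx fgx] := hP _ (unimodal_at_I01 ug1 _ Ix).
  apply: (follows_unique ug2 _ _ _ dg2 Ihgx _ fgx (follows_next _ _ fx)).
  exact: unimodal_at_I01 ug2 _ Ihx.
exists k; split => //;
  [apply: (monotone_bijection_continuous _ _ k)
  |apply: (monotone_bijection_continuous _ _ h)] => //.
- move=> x y Ix Iy; have [Ihx fx] := hP _ Ix; have [Ihy fy] := hP _ Iy.
  exact: (follows_le ug1 ug2).
- move=> x y Ix Iy; have [Ihx fx] := kP _ Ix; have [Ihy fy] := kP _ Iy.
  exact: (follows_le ug2 ug1).
Qed.

(** * Properties of a conjugacy *)

Section Conjugacy.
Context {R : realType} {g1 g2 : R -> R} {v1 v2 : R} {h : R -> R}.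
Hypotheses (ug1 : unimodal_at g1 v1) (ug2 : unimodal_at g2 v2).
Hypothesis hc : conjugacy g1 g2 h.

Lemma conjugacy_I01 (x : R) : I01 R x -> I01 R (h x).
Proof. by case: hc => -[k [[hI _] _ _ _ _] _]; exact: hI. Qed.

Lemma conjugacy_surj (y : R) : I01 R y -> exists2 x, I01 R x & h x = y.
Proof.
case: hc => -[k [[_ kI] _ kK _ _] _] Iy.
by exists (k y); [exact: kI|rewrite kK ?inE].
Qed.

Lemma conjugacy_iter (n : nat) (x : R) :
  I01 R x -> h (iter n g1 x) = iter n g2 (h x).
Proof.
case: hc => _ hg Ix; elim: n => //= n <-.
by apply: hg; rewrite inE; exact: iter_I01 ug1 _ _ Ix.
Qed.

Lemma conjugacy_increasing (x y : R) :
  I01 R x -> I01 R y -> x < y -> h x < h y.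
Proof.
case: (hc) => -[k [[hI kI] hK kK ch _]] _.
have [||inc|dec] := @itv_continuous_inj_mono R h `[0, 1].
- exact: ch.
- move=> a b Ia Ib /(congr1 k).
  by rewrite !hK ?inE.
- by move=> Ix Iy; exact: inc.
(* A decreasing conjugacy exchanges the endpoints, so that [h 0 = 1] would
   equal [g2 1 = 0]. *)
exfalso.
case: (ug1) => _ _ _ [_ _ g10 _ _]; case: (ug2) => _ _ _ [_ _ _ g21 _].
have [I0 I1] : I01 R 0 /\ I01 R 1 by rewrite !I01E; lra.
have h0 : h 0 = 1.
  have [z Iz hz] := conjugacy_surj _ I1.
  have /I01E/andP[z0 _] := Iz; move: z0; rewrite le_eqVlt => /predU1P[->//|z0].
  have := dec _ _ Iz I0 z0; rewrite hz.
  by have /I01E/andP[_ h01] := conjugacy_I01 _ I0; lra.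
have := conjugacy_iter 1 _ I0; rewrite /= g10 h0 g21; lra.
Qed.

Lemma conjugacy0 : h 0 = 0.
Proof.
have I0 : I01 R 0 by rewrite I01E; lra.
have [x Ix hx] := conjugacy_surj _ I0.
have /I01E/andP[x0 _] := Ix.
move: x0; rewrite le_eqVlt => /predU1P[e|x0]; first by rewrite {1}e.
have := conjugacy_increasing _ _ I0 Ix x0; rewrite hx.
by have /I01E/andP[h00 _] := conjugacy_I01 _ I0; lra.
Qed.

Lemma conjugacy1 : h 1 = 1.
Proof.
have I1 : I01 R 1 by rewrite I01E; lra.
have [x Ix hx] := conjugacy_surj _ I1.
have /I01E/andP[_ x1] := Ix.
move: x1; rewrite le_eqVlt => /predU1P[e|x1]; first by rewrite -{1}e.
have := conjugacy_increasing _ _ Ix I1 x1; rewrite hx.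
by have /I01E/andP[_ h11] := conjugacy_I01 _ I1; lra.
Qed.

Lemma conjugacy_turning_point : h v1 = v2.
Proof.
have Iv := turning_point_I01 ug1.
apply: (unimodal_at_max ug2); first exact: conjugacy_I01.
have := conjugacy_iter 1 _ Iv; rewrite /= => <-.
by case: (ug1) => _ _ _ [_ _ _ _ ->]; exact: conjugacy1.
Qed.

Lemma conjugacy_follows (x : R) : I01 R x -> follows g1 g2 v1 v2 x (h x).
Proof.
have hle a b : I01 R a -> I01 R b -> a <= b -> h a <= h b.
  move=> Ia Ib; rewrite le_eqVlt => /predU1P[->//|].
  by move/(conjugacy_increasing _ _ Ia Ib)/ltW.
have Iv := turning_point_I01 ug1.
move=> Ix n; rewrite -conjugacy_iter // -conjugacy_turning_point.
by split; apply: hle => //; exact: iter_I01 ug1 _ _ Ix.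
Qed.

Lemma conjugacy_dense : dense_in (I01 R) (preimage_of_zero g1) ->
  dense_in (I01 R) (preimage_of_zero g2).
Proof.
move=> /(dense_inP _ preimage_of_zero_sub) dg1.
apply/(dense_inP _ preimage_of_zero_sub) => a b Ia Ib ab.
have [x Ix hx] := conjugacy_surj _ Ia; have [y Iy hy] := conjugacy_surj _ Ib.
have xy : x < y.
  case: (ltgtP x y) => [//|yx|exy].
  - by have := conjugacy_increasing _ _ Iy Ix yx; lra.
  - by move: ab; rewrite -hx -hy exy ltxx.
have [p [n n1 [Ip gp]] /andP[xp py]] := dg1 _ _ Ix Iy xy.
exists (h p); last by rewrite -hx -hy !conjugacy_increasing.
exists n => //; split; first exact: conjugacy_I01.
by rewrite -conjugacy_iter // gp conjugacy0.
Qed.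

End Conjugacy.

Theorem theorem6 (R : realType) (g1 g2 : R -> R)
    (hg1 : unimodal g1) (hg2 : unimodal g2)
    (hd1 : dense_in (I01 R) (preimage_of_zero g1)) :
  (topologically_conjugate g1 g2 <->
     dense_in (I01 R) (preimage_of_zero g2)) /\
  (forall h h' : R -> R, conjugacy g1 g2 h -> conjugacy g1 g2 h' ->
     {in I01 R, h =1 h'}).
Proof.
have unimodalP (g : R -> R) : unimodal g -> exists v, unimodal_at g v.
  by move=> [gI gc [v v01 gv]]; exists v.
have [v1 ug1] := unimodalP _ hg1; have [v2 ug2] := unimodalP _ hg2.
split; first split.
- by case=> h hc; exact: (conjugacy_dense ug1 ug2 hc).
- exact: (dense_conjugate _ _ _ _ _ ug1 ug2).
move=> h h' hc hc' x; rewrite inE => Ix.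
apply: (follows_unique ug2 (g1 := g1) (v1 := v1) x).
- exact: (conjugacy_dense ug1 ug2 hc).
- exact: (conjugacy_I01 hc).
- exact: (conjugacy_I01 hc').
- exact: (conjugacy_follows ug1 ug2 hc).
- exact: (conjugacy_follows ug1 ug2 hc').
Qed.
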